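(* Let $X$ be a finite set with $|X|\ge 4$ and let $\mathcal S$ be a split system on $X$. Then: (i) If $\mathcal S$ contains all 2-splits of $X$, then $\mathcal S$ is injective. (ii) If $\mathcal S$ is maximal circular, then $\mathcal S$ is injective.
   Context: Let $X$ be a finite set with $|X|\ge 3$. A split of $X$ is an unordered bipartition $A|B=B|A$ of $X$ into two non-empty disjoint subsets (its parts) with $A\cup B=X$. Its size is $\min\{|A|,|B|\}$; a split of size $r$ is called an $r$-split, and a split of size 1 is called trivial. A split system on $X$ is a set $\mathcal S$ of splits of $X$ that contains all trivial splits $\{x\}|X-\{x\}$, $x\in X$. For $S\in\mathcal S$ and $x\in X$, $S(x)$ denotes the part of $S$ containing $x$. The Buneman graph $\mathcal B(\mathcal S)$ has as vertices all maps $\phi:\mathcal S\to\mathcal P(X)$ such that (B1) $\phi(S)\in S$ (i.e. $\phi(S)$ is one of the two parts of $S$) for all $S\in\mathcal S$, and (B2) $\phi(S)\cap\phi(S')\ne\emptyset$ for all distinct $S,S'\in\mathcal S$. Two vertices $\phi,\phi'$ are adjacent if there is a unique $S\in\mathcal S$ with $\phi(S)\neq\phi'(S)$. For $x\in X$, $\phi_x$ denotes the vertex $S\mapsto S(x)$. It is known that $\mathcal B(\mathcal S)$ is a median graph, i.e. it is connected and any three vertices $u,v,w$ have a unique median (a vertex lying on shortest paths between each pair of $u,v,w$). For $Y=\{x,y,z\}\in\binom X3$ (the set of 3-element subsets of $X$), $\phi_Y$ denotes the median of $\phi_x,\phi_y,\phi_z$ in $\mathcal B(\mathcal S)$. The split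 system $\mathcal S$ is injective if $\phi_Y\ne\phi_{Y'}$ for all distinct $Y,Y'\in\binom X3$. A split system $\mathcal S$ on $X$, $n=|X|$, is circular if there is a labelling $x_1,\dots,x_n$ of the elements of $X$ such that every split in $\mathcal S$ is of the form $\{x_i,x_{i+1},\dots,x_j\}\,|\,X-\{x_i,x_{i+1},\dots,x_j\}$ for some $1\le i\le j\le n$. It is maximal circular if it is circular and there is no circular split system $\mathcal S'$ on $X$ with $\mathcal S\subsetneq\mathcal S'$. *)

(* Defs.v *)
From mathcomp Require Import all_boot.

Set Implicit Arguments.
Unset Strict Implicit.
Unset Printing Implicit Defensive.

Definition is_split (X : finType) (S : {set {set X}}) : bool :=
  partition S [set: X] && (#|S| == 2).

(* The neutral element #|X| bounds the size of every part. *)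
Definition split_size (X : finType) (S : {set {set X}}) : nat :=
  \big[minn/#|X|]_(A in S) #|A|.

Definition split_of (X : finType) (A : {set X}) : {set {set X}} :=
  [set A; ~: A].

Record splitSystem (X : finType) := SplitSystem {
  splits :> {set {set {set X}}};
  splits_split : forall S, S \in splits -> is_split S;
  splits_trivial : forall x : X, split_of [set x] \in splits
}.

Definition shortest_path (T : eqType) (e : rel T) (u v : T) (p : seq T) : Prop :=
  [/\ path e u p, last u p = v
    & forall q, path e u q -> last u q = v -> size p <= size q].

Definition on_shortest_path (T : eqType) (e : rel T) (u v m : T) : Prop :=
  exists2 p, shortest_path e u v p & m \in u :: p.

Definition is_median (T : eqType) (e : rel T) (u v w m : T) : Prop :=
  [/\ on_shortest_path e u v m, on_shortest_path e v w m
    & on_shortest_path e u w m].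

Definition split_map (X : finType) (SS : splitSystem X) : finType :=
  {ffun {S : {set {set X}} | S \in splits SS} -> {set X}}.

Definition is_bvertex (X : finType) (SS : splitSystem X)
    (phi : split_map SS) : bool :=
  [forall S, phi S \in val S]
  && [forall S, forall S', (S != S') ==> (phi S :&: phi S' != set0)].

Definition bvertex (X : finType) (SS : splitSystem X) : finType :=
  {phi : split_map SS | is_bvertex phi}.

Definition badj (X : finType) (SS : splitSystem X) : rel (bvertex SS) :=
  fun phi psi => #|[set S | val phi S != val psi S]| == 1.

(* For a split S, pblock S x is the part of S containing x. *)
Definition bmap_of (X : finType) (SS : splitSystem X) (x : X) : split_map SS :=
  [ffun S : {S | S \in splits SS} => pblock (val S) x].

Lemma mem_split_pblock (X : finType) (S : {set {set X}}) (x : X) :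
  is_split S -> (pblock S x \in S) /\ (x \in pblock S x).
Proof.
move=> /andP[/and3P[/eqP cS _ _] _].
by split; [apply: pblock_mem | rewrite mem_pblock]; rewrite cS inE.
Qed.

Lemma bmap_ofP (X : finType) (SS : splitSystem X) (x : X) :
  is_bvertex (bmap_of SS x).
Proof.
have P (S : {S | S \in splits SS}) :
    (pblock (val S) x \in val S) /\ (x \in pblock (val S) x).
  by apply/mem_split_pblock/(splits_split (valP S)).
apply/andP; split; apply/forallP => S; first by rewrite ffunE; case: (P S).
apply/forallP => S'; apply/implyP => _; rewrite !ffunE.
by apply/set0Pn; exists x; rewrite inE; case: (P S) => _ ->; case: (P S').
Qed.

Definition bvertex_of (X : finType) (SS : splitSystem X) (x : X) : bvertex SS :=
  exist _ (bmap_of SS x) (bmap_ofP SS x).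

(* The Buneman graph is a median graph: the graph distance of two vertices is  *)
(* the number of splits on which they differ, and medians are majority maps.   *)

Lemma split_partC (X : finType) (S : {set {set X}}) (A B : {set X}) :
  is_split S -> A \in S -> B \in S -> A != B -> B = ~: A.
Proof.
move=> /andP[/and3P[/eqP cS /trivIsetP tS _] /eqP S2] AS BS AB.
have SE : [set A; B] = S.
  apply/eqP; rewrite eqEcard cards2 AB S2 andbT.
  by apply/subsetP => C; rewrite !inE => /orP[]/eqP->.
have := tS _ _ AS BS AB; rewrite disjoints_subset => sub.
apply/eqP; rewrite eqEsubset -disjoints_subset disjoint_sym disjoints_subset sub /=.
apply/subsetP => x; rewrite inE => xA.
have : x \in cover S by rewrite cS inE.
by rewrite -SE => /bigcupP[C]; rewrite !inE => /orP[]/eqP->; rewrite ?(negPf xA).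
Qed.

Definition bdiff (X : finType) (SS : splitSystem X) (u v : bvertex SS) :
    {set {S : {set {set X}} | S \in splits SS}} :=
  [set S | val u S != val v S].

Lemma bvertex_mem (X : finType) (SS : splitSystem X) (u : bvertex SS) S :
  val u S \in val S.
Proof. by case/andP: (valP u) => /forallP. Qed.

Lemma bvertex_meet (X : finType) (SS : splitSystem X) (u : bvertex SS) S S' :
  S != S' -> val u S :&: val u S' != set0.
Proof. by case/andP: (valP u) => _ /forallP/(_ S)/forallP/(_ S')/implyP. Qed.

Lemma bvertex_partC (X : finType) (SS : splitSystem X) (u v : bvertex SS) S :
  val u S != val v S -> val v S = ~: val u S.
Proof.
by apply: (split_partC (splits_split (valP S))); apply: bvertex_mem.
Qed.

Lemma bvertex_maj (X : finType) (SS : splitSystem X) (u v w : bvertex SS) S :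
  val u S != val v S -> val v S != val w S -> val u S = val w S.
Proof.
by move=> uv vw; rewrite (bvertex_partC vw) (bvertex_partC uv) setCK.
Qed.

Lemma bdiff_step (X : finType) (SS : splitSystem X) (u v : bvertex SS) :
  bdiff u v != set0 ->
  exists2 u', badj u u' & #|bdiff u v| = #|bdiff u' v|.+1.
Proof.
case/set0Pn => S0 S0d.
case: (@arg_minnP _ S0 [in bdiff u v] (fun S => #|val u S|) S0d) => S Sd Smin.
pose f : split_map SS := [ffun S' => if S' == S then val v S else val u S'].
have uvS : val u S != val v S by rewrite inE in Sd.
have meetS S' : S' != S -> val v S :&: val u S' != set0.
  move=> nS; apply/negP => /eqP e0.
  have sub : val u S' \subset val u S.
    rewrite -[val u S]setCK -(bvertex_partC uvS) -disjoints_subset.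
    by rewrite -setI_eq0 setIC e0.
  case: (boolP (S' \in bdiff u v)) => [S'd|]; last first.
    rewrite inE negbK => /eqP uvS'; have := bvertex_meet v nS.
    by rewrite -uvS' setIC e0 eqxx.
  have E : val u S' = val u S.
    by apply/eqP; rewrite eqEcard sub Smin.
  case/eqP: nS; apply/val_inj.
  have split_E (S1 : {S | S \in splits SS}) : val S1 = split_of (val u S1).
    have sS1 := splits_split (valP S1).
    apply/eqP; rewrite eq_sym eqEcard.
    have /andP[/and3P[/eqP cS1 _ n0] /eqP ->] := sS1.
    have uS1 := bvertex_mem u S1.
    have [B BS nB] : exists2 B, B \in val S1 & val u S1 != B.
      have /andP[_ /eqP/esym] := sS1.
      rewrite (cardsD1 (val u S1)) uS1 add1n => -[] /esym c1.
      have /cards1P[B EB] : #|val S1 :\ val u S1| == 1 by rewrite -c1.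
      have : B \in val S1 :\ val u S1 by rewrite EB set11.
      by rewrite !inE eq_sym => /andP[nB BS]; exists B.
    have EB := split_partC sS1 uS1 BS nB.
    rewrite cards2 -EB nB andbT.
    by apply/subsetP => C; rewrite !inE -EB => /orP[]/eqP->.
  by rewrite !split_E E.
have fP : is_bvertex f.
  apply/andP; split; apply/forallP => S1.
    by rewrite ffunE; case: (eqVneq S1 S) => [->|_]; apply: bvertex_mem.
  apply/forallP => S2; apply/implyP => n12; rewrite !ffunE.
  case: (eqVneq S1 S) => [E1|n1]; case: (eqVneq S2 S) => [E2|n2].
  - by rewrite E1 E2 eqxx in n12.
  - exact: meetS.
  - by rewrite setIC meetS.
  - exact: bvertex_meet.
exists (exist _ f fP).
  apply/cards1P; exists S; apply/setP => S1; rewrite !inE /= ffunE.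
  by case: (eqVneq S1 S) => [->|_]; rewrite ?uvS ?eqxx.
rewrite (cardsD1 S) Sd add1n; congr _.+1; apply: eq_card => S1.
by rewrite !inE /= ffunE; case: (eqVneq S1 S) => [->|_] //=; rewrite eqxx.
Qed.

Lemma bpath_ex (X : finType) (SS : splitSystem X) (u v : bvertex SS) :
  exists p, [/\ path (@badj X SS) u p, last u p = v & size p = #|bdiff u v|].
Proof.
move E: #|bdiff u v| => n; elim: n u E => [|n IH] u E.
  exists [::]; split=> //=; apply/val_inj/ffunP => S; apply/eqP/negPn/negP => nS.
  by move/eqP: E; rewrite cards_eq0 => /eqP/setP/(_ S); rewrite !inE nS.
have [|u' a E'] := @bdiff_step X SS u v; first by rewrite -cards_eq0 E.
have [|p [pp lp sp]] := IH u'; first by move: E'; rewrite E => -[].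
by exists (u' :: p); rewrite /= a pp sp.
Qed.

Lemma bdiff_tri (X : finType) (SS : splitSystem X) (u v w : bvertex SS) :
  bdiff u w \subset bdiff u v :|: bdiff v w.
Proof.
by apply/subsetP => S; rewrite !inE; case: (eqVneq (val u S) (val v S)) => //= ->.
Qed.

Lemma bpath_size (X : finType) (SS : splitSystem X) (u : bvertex SS) p :
  path (@badj X SS) u p -> #|bdiff u (last u p)| <= size p.
Proof.
elim: p u => [|a p IH] u /=.
  by move=> _; rewrite leqn0 cards_eq0; apply/eqP/setP => S; rewrite !inE eqxx.
case/andP => /eqP ua /IH le.
apply: (leq_trans (subset_leq_card (bdiff_tri u a _))).
by rewrite cardsU (leq_trans (leq_subr _ _)) // -add1n leq_add // -ua.
Qed.

Lemma on_shortest_pathP (X : finType) (SS : splitSystem X) (u v m : bvertex SS) :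
  on_shortest_path (@badj X SS) u v m <->
  (forall S, val u S = val v S -> val m S = val u S).
Proof.
split.
  case=> p [pp lp pmin] mp S uvS; apply/eqP/negPn/negP => nm.
  have [q [pq lq sq]] := bpath_ex u v.
  have {pmin} := pmin _ pq lq; rewrite {q pq lq}sq => le.
  have : #|bdiff u m| + #|bdiff m v| <= size p.
    move: mp pp lp; case/splitPl => p1 p2 E; rewrite cat_path last_cat E.
    case/andP => pp1 pp2 lp; rewrite size_cat leq_add //.
      by rewrite -[in X in X <= _]E bpath_size.
    by rewrite -lp bpath_size.
  move/leq_trans/(_ le); apply/negP; rewrite -ltnNge.
  rewrite -cardsUI -[X in X < _]addn0.
  rewrite -addnS leq_add ?subset_leq_card ?bdiff_tri // card_gt0.
  by apply/set0Pn; exists S; rewrite !inE eq_sym nm -uvS nm.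
move=> H; have [p [pp lp sp]] := bpath_ex u m.
have [q [pq lq sq]] := bpath_ex m v.
exists (p ++ q); last by rewrite -cat_cons mem_cat -[X in X \in _]lp mem_last.
split; rewrite ?cat_path ?last_cat ?pp ?lp //.
move=> r pr lr; apply: leq_trans (bpath_size pr); rewrite lr size_cat sp sq.
rewrite -cardsUI [X in _ + X](_ : _ = 0) ?addn0.
  apply/subset_leq_card/subsetP => S; rewrite !inE; apply: contraLR.
  by rewrite negbK => /eqP e; rewrite -e H // eqxx.
apply/eqP; rewrite cards_eq0; apply/eqP/setP => S; rewrite !inE.
apply/negP => /andP[um mv]; have := bvertex_maj um mv => /H mu.
by rewrite mu eqxx in um.
Qed.

Lemma bmedian_subproof (X : finType) (SS : splitSystem X) (u v w : bvertex SS) :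
  {m | is_median (@badj X SS) u v w m
       & forall m', is_median (@badj X SS) u v w m' -> m' = m}.
Proof.
pose f : split_map SS := [ffun S => if val u S == val v S then val u S else val w S].
have f2 S : [\/ f S = val u S /\ f S = val v S, f S = val u S /\ f S = val w S
              | f S = val v S /\ f S = val w S].
  rewrite ffunE; case: eqP => [E|/eqP n1]; first by apply: Or31; rewrite E.
  case: (eqVneq (val v S) (val w S)) => [->|n2]; first by apply: Or33.
  by apply: Or32; rewrite (bvertex_maj n1 n2).
have fP : is_bvertex f.
  apply/andP; split; apply/forallP => S.
    by case: (f2 S) => -[-> _]; apply: bvertex_mem.
  apply/forallP => S'; apply/implyP => n.
  suff [t [-> ->]] : exists t : bvertex SS, f S = val t S /\ f S' = val t S'.
    exact: bvertex_meet.
  by case: (f2 S) => -[a b]; case: (f2 S') => -[a' b'];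
    [exists u|exists u|exists v|exists u|exists u|exists w|exists v|exists w|exists v].
have [m mE] : {m : bvertex SS | forall S, val m S = f S} by exists (exist _ f fP).
exists m.
  split; apply/on_shortest_pathP => S E; rewrite mE;
    by case: (f2 S) => -[a b]; congruence.
move=> m' [/on_shortest_pathP uv /on_shortest_pathP vw /on_shortest_pathP uw].
apply/val_inj/ffunP => S; rewrite mE.
case: (f2 S) => -[a b]; rewrite a; [apply: uv|apply: uw|apply: vw]; congruence.
Qed.

Definition bmedian (X : finType) (SS : splitSystem X) (u v w : bvertex SS) :
  bvertex SS := s2val (bmedian_subproof u v w).

Lemma bmedianP (X : finType) (SS : splitSystem X) (u v w : bvertex SS) :
  is_median (@badj X SS) u v w (bmedian u v w).
Proof. exact: s2valP. Qed.

Lemma bmedian_unique (X : finType) (SS : splitSystem X) (u v w m : bvertex SS) :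
  is_median (@badj X SS) u v w m -> m = bmedian u v w.
Proof. exact: (s2valP' (bmedian_subproof u v w)). Qed.

Definition injective_system (X : finType) (SS : splitSystem X) : Prop :=
  forall x y z x' y' z' : X,
    #|[set x; y; z]| = 3 -> #|[set x'; y'; z']| = 3 ->
    [set x; y; z] <> [set x'; y'; z'] ->
    bmedian (bvertex_of SS x) (bvertex_of SS y) (bvertex_of SS z)
    <> bmedian (bvertex_of SS x') (bvertex_of SS y') (bvertex_of SS z').

Definition circular (X : finType) (SS : splitSystem X) : Prop :=
  exists2 f : 'I_#|X| -> X, bijective f &
    forall S, S \in splits SS ->
      exists i j : 'I_#|X|,
        i <= j /\ S = split_of [set f k | k : 'I_#|X| & i <= k <= j].

Definition maximal_circular (X : finType) (SS : splitSystem X) : Prop :=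
  circular SS /\
  ~ exists SS' : splitSystem X, circular SS' /\ splits SS \proper splits SS'.

(* Main.v *)
Require Import Defs.
From mathcomp Require Import all_boot.
From mathcomp Require Import zify.

(** The median of [phi_x], [phi_y], [phi_z] sends a split to its part containing
    at least two of [x], [y], [z], so injectivity says that any two distinct
    triples are told apart, in this majority sense, by some split.  With all
    2-splits, take a pair of elements of [Y] not contained in [Y'].  A maximal
    circular system contains all interval splits, and the intervals that contain
    at least two of the positions [a < b < c] determine first [b] (among the
    initial intervals), then [a] and [c] (among those ending, resp. starting,
    at [b]). *)

(** * Splits given by one part, and their sizes *)

Lemma split_ofP (X : finType) (A : {set X}) :
  A != set0 -> ~: A != set0 -> is_split (split_of A).
Proof.
move=> A0 CA0.
have nA : A != ~: A.
  apply: contra A0 => /eqP E; apply/eqP/setP => x; rewrite inE.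
  by apply/negP => xA; have := xA; rewrite E inE xA.
rewrite /is_split /split_of cards2 nA andbT; apply/and3P; split.
- by rewrite /cover big_setU1 ?inE //= big_set1 setUCr.
- apply/trivIsetP => B C; rewrite !inE.
  by move=> /orP[]/eqP-> /orP[]/eqP->; rewrite ?eqxx // => _;
    rewrite -setI_eq0 ?setICr // setIC setICr.
- by rewrite !inE negb_or ![set0 == _]eq_sym A0.
Qed.

Lemma bigmin_le (T : eqType) (r : seq T) (P : pred T) (F : T -> nat) n x :
  x \in r -> P x -> \big[minn/n]_(i <- r | P i) F i <= F x.
Proof.
elim: r => // y r IH; rewrite inE big_cons => /orP[/eqP<- ->|xr Px].
  exact: geq_minl.
by case: ifP => _; rewrite ?geq_min IH ?orbT.
Qed.

Lemma split_size_pair (X : finType) (A : {set X}) :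
  4 <= #|X| -> #|A| = 2 -> split_size (split_of A) = 2.
Proof.
move=> hX cA; apply/eqP; rewrite eqn_leq; apply/andP; split.
  by rewrite -[X in _ <= X]cA bigmin_le ?mem_index_enum ?inE ?eqxx.
(* The bound 2 holds for the initial value [#|X|], survives [minn], and holds for both parts, since
   the complement has [#|X| - 2] elements. *)
rewrite /split_size; elim/big_ind: _ => [|m n m2 n2|B].
- exact: leq_trans hX.
- by rewrite leq_min m2.
- rewrite !inE => /orP[]/eqP->; first by rewrite cA.
  by have := cardsC A; rewrite cA; lia.
Qed.

(** * Medians as majority maps *)

Lemma bvertex_of_partE {X : finType} {SS : splitSystem X} (x : X)
    (S : {S | S \in splits SS}) (A : {set X}) :
  val S = split_of A -> val (bvertex_of SS x) S = if x \in A then A else ~: A.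
Proof.
move=> E; have sS := splits_split (valP S).
have /andP[/and3P[_ tS _] _] := sS.
rewrite /= ffunE; case: ifP => xA; apply: def_pblock => //; rewrite ?E ?inE ?eqxx ?orbT //.
by rewrite xA.
Qed.

(** Two of the three points always lie in the same part of the split, and the median, being on a
    shortest path between their vertices, keeps this common value. *)
Lemma bmedian_partE {X : finType} {SS : splitSystem X} (x y z : X)
    (S : {S | S \in splits SS}) (A : {set X}) :
  val S = split_of A ->
  val (bmedian (bvertex_of SS x) (bvertex_of SS y) (bvertex_of SS z)) S =
  if 1 < (x \in A) + (y \in A) + (z \in A) then A else ~: A.
Proof.
move=> E; have [] := bmedianP (bvertex_of SS x) (bvertex_of SS y) (bvertex_of SS z).
move=> /on_shortest_pathP/(_ S) xy /on_shortest_pathP/(_ S) yz.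
move=> /on_shortest_pathP/(_ S) xz; move: xy yz xz.
rewrite !(bvertex_of_partE _ _ _ E).
case: (x \in A); case: (y \in A); case: (z \in A) => /= xy yz xz;
  by [apply: xy | apply: yz | apply: xz].
Qed.

Lemma card_setI_triple (X : finType) (A : {set X}) (x y z : X) :
  #|[set x; y; z]| = 3 ->
  #|A :&: [set x; y; z]| = (x \in A) + (y \in A) + (z \in A).
Proof.
move=> c3; have {c3} : uniq [:: x; y; z].
  have -> : uniq [:: x; y; z] = (#|[:: x; y; z]| == 3).
    by apply/idP/eqP => [/card_uniqP|/card_uniqP].
  by rewrite -c3; apply/eqP/eq_card => t; rewrite !inE orbA.
move=> u; rewrite -sum1_card.
rewrite (eq_bigl (fun t => (t \in [:: x; y; z]) && (t \in A))); last first.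
  by move=> t; rewrite !inE orbA andbC.
rewrite big_mkcondr -big_uniq //= !big_cons big_nil addn0 addnA.
by case: (x \in A); case: (y \in A); case: (z \in A).
Qed.

Lemma injective_of_majority (X : finType) (SS : splitSystem X) :
  (forall Y Y' : {set X}, #|Y| = 3 -> #|Y'| = 3 -> Y != Y' ->
    exists2 A, split_of A \in splits SS
             & (1 < #|A :&: Y|) != (1 < #|A :&: Y'|)) ->
  injective_system SS.
Proof.
move=> sep x y z x' y' z' cY cY' /eqP /(sep _ _ cY cY')[A SA].
rewrite (card_setI_triple _ _ _ _ _ cY) (card_setI_triple _ _ _ _ _ cY') => nmaj E.
have ES : val (exist (fun S => S \in splits SS) _ SA) = split_of A by [].
have := bmedian_partE x y z _ _ ES; rewrite {}E (bmedian_partE _ _ _ _ _ ES).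
(* Any point [t] of [X] lies in exactly one of [A] and [~: A], so these two values of the medians
   differ. *)
have /set0Pn[t _] : [set x; y; z] != set0 by rewrite -card_gt0 cY.
by move: nmaj; case: ifP; case: ifP => // _ _ _ /setP/(_ t);
  rewrite inE; case: (t \in A).
Qed.

(** * Systems with all 2-splits *)

Lemma injective_of_2splits (X : finType) (SS : splitSystem X) :
  4 <= #|X| ->
  (forall S, is_split S -> split_size S = 2 -> S \in splits SS) ->
  injective_system SS.
Proof.
move=> hX H; apply: injective_of_majority => Y Y' cY cY' nYY'.
have /subsetPn[c cY1 cY'1] : ~~ (Y \subset Y').
  by apply: contra nYY' => s; rewrite eqEcard s cY cY'.
have /set0Pn[a] : Y :\ c != set0.
  by rewrite -card_gt0; have := cardsD1 c Y; rewrite cY cY1; lia.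
rewrite !inE => /andP[ac aY].
have c2 : #|[set a; c]| = 2 by rewrite cards2 ac.
exists [set a; c].
  apply: H; last exact: split_size_pair.
  apply: split_ofP; first by rewrite -card_gt0 c2.
  by rewrite -card_gt0; have := cardsC [set a; c]; rewrite c2; lia.
(* The pair lies inside [Y], while at most [a] lies in [Y']. *)
have -> : [set a; c] :&: Y = [set a; c].
  by apply/setIidPl/subsetP => t; rewrite !inE => /orP[]/eqP->.
rewrite c2; have : [set a; c] :&: Y' \subset [set a].
  apply/subsetP => t; rewrite !inE => /andP[/orP[//|/eqP->]].
  by rewrite (negPf cY'1).
by move/subset_leq_card; rewrite cards1 [1 < #|_ :&: _|]ltnNge => ->.
Qed.

(** * Maximal circular systems *)

Definition arc {X : finType} (f : 'I_#|X| -> X) (i j : nat) : {set X} :=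
  [set f k | k : 'I_#|X| & i <= k <= j].

Lemma mem_arc {X : finType} {f : 'I_#|X| -> X} {i j : nat} {k : 'I_#|X|} :
  injective f -> (f k \in arc f i j) = (i <= k <= j).
Proof. by move=> fI; rewrite mem_imset // inE. Qed.

(** Adjoining every interval split for the same labelling [f] keeps the system circular, so a
    missing one would contradict maximality. *)
Lemma maximal_circular_arcs (X : finType) (SS : splitSystem X) :
  maximal_circular SS ->
  exists2 f : 'I_#|X| -> X, bijective f &
    forall i j : 'I_#|X|, i <= j -> is_split (split_of (arc f i j)) ->
      split_of (arc f i j) \in splits SS.
Proof.
case=> -[f fB fS] maxS; exists f => // i j ij sij; apply/negPn/negP => nS.
pose Q := [set S | is_split S &
  [exists i : 'I_#|X|, exists j : 'I_#|X|, (i <= j) && (S == split_of (arc f i j))]].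
have QS S : S \in splits SS -> S \in Q.
  move=> SS_S; rewrite inE (splits_split SS_S) /=.
  have [k [l [kl E]]] := fS _ SS_S.
  by apply/existsP; exists k; apply/existsP; exists l; rewrite kl E eqxx.
have Q1 S : S \in Q -> is_split S by rewrite inE => /andP[].
pose SQ := SplitSystem Q1 (fun x => QS _ (splits_trivial SS x)).
apply: maxS; exists SQ; split.
  exists f => // S; rewrite inE => /andP[_ /existsP[k /existsP[l /andP[kl /eqP E]]]].
  by exists k, l.
apply/properP; split; first by apply/subsetP => S; apply: QS.
exists (split_of (arc f i j)) => //; rewrite inE sij /=.
by apply/existsP; exists i; apply/existsP; exists j; rewrite ij eqxx.
Qed.

Lemma sorted_triple (n : nat) (Z : {set 'I_n}) :
  #|Z| = 3 -> exists a b c : 'I_n, [/\ a < b, b < c & Z = [set a; b; c]].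
Proof.
move=> cZ; have : sorted ltn (map val (enum Z)).
  (* The enumeration of a set of ordinals is a subsequence of 0, ..., n-1. *)
  rewrite sorted_map {1}/enum_mem -enumT sorted_filter //.
    by move=> ? ? ?; apply: ltn_trans.
  by rewrite -sorted_map val_enum_ord iota_ltn_sorted.
have EZ := mem_enum Z.
have : size (enum Z) = 3 by rewrite -cardE.
move: EZ; case: (enum Z) => [|a [|b [|c []]]] //= EZ _ /and3P[ab bc _].
by exists a, b, c; split=> //; apply/setP => t; rewrite -EZ !inE orbA.
Qed.

(** The side condition on [i] and [j] excludes only the full interval, whose complement is empty and
    which therefore yields no split. *)
Lemma majority_interval (n a b c a' b' c' : nat) :
  a < b -> b < c -> c < n -> a' < b' -> b' < c' -> c' < n ->
  (forall i j, i <= j -> j < n -> (0 < i) || (j.+1 < n) ->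
    (1 < (i <= a <= j) + (i <= b <= j) + (i <= c <= j)) =
    (1 < (i <= a' <= j) + (i <= b' <= j) + (i <= c' <= j))) ->
  [/\ a = a', b = b' & c = c'].
Proof.
move=> ab bc cn ab' bc' cn' H.
have Eb : b = b'.
  (* The interval from 0 to [j] holds a majority iff [b <= j]; it is not full for [j = b], because
     [c] lies beyond. *)
  have h := H 0 b; have h' := H 0 b'; lia.
subst b'; split=> //.
  (* An interval ending at [b] misses [c], so its majority must be [a] and [b]; dually, one starting
     at [b] needs [c]. *)
  have h := H a b; have h' := H a' b; lia.
have h := H b c; have h' := H b c'; lia.
Qed.

Lemma injective_of_maximal_circular (X : finType) (SS : splitSystem X) :
  maximal_circular SS -> injective_system SS.
Proof.
move=> /maximal_circular_arcs[f fB fS]; have fI := bij_inj fB.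
have triple (Y : {set X}) : #|Y| = 3 ->
    exists a b c : 'I_#|X|, [/\ a < b, b < c & Y = [set f a; f b; f c]].
  move=> cY; have [|a [b [c [ab bc E]]]] := sorted_triple _ (f @^-1: Y).
    by rewrite on_card_preimset //; apply: onW_bij.
  exists a, b, c; split=> //; have [g fK gK] := fB.
  apply/setP => t; rewrite -(gK t); have /setP/(_ (g t)) := E.
  by rewrite !inE !(inj_eq fI).
apply: injective_of_majority => Y Y' cY cY' nYY'.
have [a [b [c [ab bc EY]]]] := triple Y cY.
have [a' [b' [c' [ab' bc' EY']]]] := triple Y' cY'.
(* If no split separates the triples, all arcs agree on them and the sorted positions coincide. *)
have [/exists_inP[A SA nA]|/exists_inPn nE] := boolP [exists A in
    [pred A | split_of A \in splits SS], (1 < #|A :&: Y|) != (1 < #|A :&: Y'|)].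
  by exists A.
have [|/val_inj Ea /val_inj Eb /val_inj Ec] :=
  @majority_interval #|X| a b c a' b' c' ab bc (ltn_ord c) ab' bc' (ltn_ord c').
  move=> i j ij jn pr; pose oi := Ordinal (leq_ltn_trans ij jn).
  pose oj := Ordinal jn.
  have SA : split_of (arc f oi oj) \in splits SS.
    apply: fS => //; apply: split_ofP; apply/set0Pn.
      by exists (f oi); rewrite mem_arc //= leqnn.
    (* A point outside the arc: position 0 if the arc starts later, otherwise position [j.+1]. *)
    have [i0|j1] := orP pr.
      by exists (f (Ordinal (leq_ltn_trans (leq0n i) (ltn_ord oi))));
        rewrite inE mem_arc //= leqNgt i0.
    by exists (f (Ordinal j1)); rewrite inE mem_arc //= ltnn andbF.
  have := nE _ SA; rewrite negbK => /eqP.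
  by rewrite EY EY' !card_setI_triple -?EY -?EY' // !mem_arc.
by rewrite EY EY' Ea Eb Ec eqxx in nYY'.
Qed.

Theorem theorem1 (X : finType) (SS : splitSystem X) (hX : 4 <= #|X|) :
  ((forall S : {set {set X}}, is_split S -> split_size S = 2 -> S \in splits SS) ->
     injective_system SS) /\
  (maximal_circular SS -> injective_system SS).
Proof.
split; [exact: injective_of_2splits | exact: injective_of_maximal_circular].
Qed.
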